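(* For any real constant $\lambda > 0$ and any integer $n_0 > 0$, there exist an integer $x$, a bipartite graph $H$ containing a matching of size $x$ and at most $\lambda x$ unmatched vertices (that is, $H$ has a matching consisting of $x$ edges such that at most $\lambda x$ vertices of $H$ are not covered by it), and a triangle-free non-bipartite graph $G$ on more than $n_0$ vertices, such that the number of copies of $H$ in $G$ is strictly larger than the number of copies of $H$ in any bipartite graph on the same number of vertices as $G$.
   Context: All graphs are finite and simple. The number of copies of $H$ in $G$ is the number of subgraphs of $G$ (not necessarily induced) isomorphic to $H$. *)

(* Defs.v *)
From mathcomp Require Import all_boot.

Set Implicit Arguments.
Unset Strict Implicit.
Unset Printing Implicit Defensive.

Record sgraph := SGraph {
  vertex :> finType;
  adj : rel vertex;
  adj_sym : symmetric adj;
  adj_irrefl : irreflexive adj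
}.
Arguments adj {s}.

Definition edges (G : sgraph) : {set {set G}} :=
  [set [set p.1; p.2] | p in [set p : G * G | adj p.1 p.2]].

Definition bipartite (G : sgraph) : Prop :=
  exists A : {set G}, forall x y : G, adj x y -> (x \in A) != (y \in A).

Definition triangle_free (G : sgraph) : Prop :=
  forall x y z : G, ~~ [&& adj x y, adj y z & adj x z].

Definition matching (G : sgraph) (M : {set {set G}}) : bool :=
  (M \subset edges G) && trivIset M.

Definition unmatched (G : sgraph) (M : {set {set G}}) : {set G} := ~: cover M.

(* A candidate subgraph is a pair (vertex set, edge set). *)
Definition subgraph (G : sgraph) (S : {set G} * {set {set G}}) : bool :=
  (S.2 \subset edges G) && [forall e in S.2, e \subset S.1].

(* f is a bijection from the vertices of H onto those of S that preserves
   and reflects adjacency, adjacency in S being given by its own edge set. *)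
Definition isomorphism (H G : sgraph) (S : {set G} * {set {set G}})
    (f : {ffun H -> G}) : bool :=
  [&& injectiveb f, f @: [set: H] == S.1 &
      [forall u : H, forall v : H, adj u v == ([set f u; f v] \in S.2)]].

Definition copies (H G : sgraph) : nat :=
  #|[set S : {set G} * {set {set G}} |
      subgraph S && [exists f : {ffun H -> G}, isomorphism S f]]|.

(* Main.v *)
Require Import Defs.
From mathcomp Require Import all_boot all_order all_algebra.
From mathcomp Require Import reals.
From mathcomp Require Import perm zify.
Import Order.TTheory GRing.Theory Num.Theory.

(** Take two copies of the complete bipartite graph K_{p+1,q}, with p > q, hang
    a pendant vertex (the tip) on one vertex (the root) of each large side, and
    join the two tips.  The resulting graph H is connected and bipartite, and
    its two large sides lie in opposite colour classes, since the roots are at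
    distance 3.  It has 2(p+q+2) vertices, and a matching leaves only 2(p-q)
    of them uncovered.

    Let G be K_{2(p+1),2q} with a path of length 3 added between two vertices,
    again called roots, of its large side.  It has as many vertices as H, it is
    triangle-free, and it contains a 5-cycle.  The odd detour lets both large
    sides of H fall into the same large side of G: all permutations of the
    non-root vertices of each side give embeddings of H in G, so there are at
    least (2p)! (2q)! of them ([embeddings_into_thick]).

    In a bipartite graph B on the same number 2h of vertices, h = p+q+2, the
    2-colouring of the connected graph H is forced up to a swap, and H has h
    vertices of each colour.  Hence B has two classes of size h or contains no
    copy of H, and there are at most 2 h!^2 embeddings
    ([embeddings_into_bipartite]).  Copies are embeddings up to the
    automorphisms of H ([copies_mul_automorphisms]), so it suffices that
    (2p)! (2q)! > 2 (p+q+2)!^2.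

    With q = k u and p = q + u, the ratio (2p)! (2q)! / (p+q)!^2 is at least
    (1 + 1/(2k+1))^u, which is exponential in u, whereas (p+q+2)!^2 / (p+q)!^2
    is polynomial in u.  So a large u works ([unbalanced_factorials_win]), and
    the ratio of uncovered vertices to matching edges stays below 1/k. *)

Set Implicit Arguments.
Unset Strict Implicit.
Unset Printing Implicit Defensive.

(** * Embeddings and copies *)

Lemma in_edges (G : sgraph) (x y : G) : ([set x; y] \in edges G) = adj x y.
Proof.
apply/imsetP/idP => [[[a b]] | xy]; last by exists (x, y); rewrite ?inE.
rewrite inE /= => ab eq_xy.
have aNb : a != b by apply/eqP => eq_ab; rewrite eq_ab adj_irrefl in ab.
have xNy : x != y by have := cards2 x y; rewrite eq_xy cards2 aNb; case: (x != y).
have := set21 x y; have := set22 x y; rewrite eq_xy !inE.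
by do 2!case/orP=> /eqP ?; subst; rewrite ?eqxx // adj_sym in xNy *.
Qed.

Definition embeddings (H G : sgraph) : {set {ffun H -> G}} :=
  [set f : {ffun H -> G} | injectiveb f &&
     [forall u, forall v, adj u v ==> adj (f u) (f v)]].

Lemma embeddingsP (H G : sgraph) (f : {ffun H -> G}) :
  reflect (injective f /\ forall u v : H, adj u v -> adj (f u) (f v))
          (f \in embeddings H G).
Proof.
rewrite inE; apply: (iffP andP) => -[f_inj f_hom]; split.
- exact/injectiveP.
- by move=> u v; move/forallP/(_ u)/forallP/(_ v)/implyP: f_hom; apply.
- exact/injectiveP.
- by apply/forallP=> u; apply/forallP=> v; apply/implyP/f_hom.
Qed.

Definition image_subgraph (H G : sgraph) (f : {ffun H -> G}) :
    {set G} * {set {set G}} :=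
  (f @: [set: H], [set [set f p.1; f p.2] | p in [set p : H * H | adj p.1 p.2]]).

Lemma set2_inj_adj (H : sgraph) (T : finType) (f : H -> T) (a b u v : H) :
  injective f -> adj a b -> [set f u; f v] = [set f a; f b] -> adj u v.
Proof.
move=> f_inj ab /setP eq_uv; rewrite -in_edges.
suff -> : [set u; v] = [set a; b] by rewrite in_edges.
by apply/setP=> z; have := eq_uv (f z); rewrite !inE !(inj_eq f_inj).
Qed.

(** A copy together with a parametrisation is the same thing as an embedding:
    the subgraph is recovered from the map as its image. *)
Lemma isomorphism_onto (H G : sgraph) (f : {ffun H -> G}) S :
  (subgraph S && isomorphism S f)
    = (f \in embeddings H G) && (S == image_subgraph f).
Proof.
apply/andP/andP => [[/andP[S2G /forallP S2S1]] | [/embeddingsP[f_inj f_hom] /eqP ->]].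
  case/and3P=> /injectiveP f_inj /eqP fS1 /forallP adjE.
  have {}adjE u v : adj u v = ([set f u; f v] \in S.2).
    by apply/eqP; move/forallP: (adjE u).
  split.
    apply/embeddingsP; split=> // u v; rewrite adjE => /(subsetP S2G).
    by rewrite in_edges.
  case: S => S1 S2 /= in S2G S2S1 fS1 adjE *.
  apply/eqP; congr (_, _); first by rewrite fS1.
  apply/setP=> e; apply/idP/imsetP => [eS | [[u v]]]; last first.
    by rewrite inE /= adjE => ? ->.
  have /imsetP[[x y] _ /= e_xy] := subsetP S2G _ eS.
  have /subsetP sub_e := implyP (S2S1 e) eS; rewrite -fS1 in sub_e.
  have /imsetP[u _ xu] : x \in f @: [set: H] by apply: sub_e; rewrite e_xy set21.
  have /imsetP[v _ yv] : y \in f @: [set: H] by apply: sub_e; rewrite e_xy set22.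
  by exists (u, v); rewrite /= -?xu -?yv // inE /= adjE -xu -yv -e_xy.
split.
  apply/andP; split.
    apply/subsetP=> _ /imsetP[[u v] uv ->]; rewrite inE /= in uv.
    by rewrite in_edges f_hom.
  apply/forallP=> e; apply/implyP=> /imsetP[[u v] _ ->] /=.
  by apply/subsetP=> z; rewrite !inE => /orP[] /eqP->; apply: imset_f.
apply/and3P; split=> //; first exact/injectiveP.
apply/forallP=> u; apply/forallP=> v; apply/eqP=> /=.
apply/idP/imsetP => [uv | [[a b]]].
  by exists (u, v); rewrite ?inE.
by rewrite inE /= => ab /(set2_inj_adj f_inj ab).
Qed.

Definition automorphisms (H : sgraph) : {set {ffun H -> H}} :=
  [set s : {ffun H -> H} | injectiveb s && [forall u, forall v, adj u v == adj (s u) (s v)]].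

(** Two embeddings with the same image differ by precomposition with an
    automorphism of [H]. *)
Lemma card_fiber (H G : sgraph) (f : {ffun H -> G}) :
  f \in embeddings H G ->
  #|[set g in embeddings H G | image_subgraph g == image_subgraph f]|
    = #|automorphisms H|.
Proof.
move=> f_emb; have /embeddingsP[f_inj f_hom] := f_emb.
have f_iso : isomorphism (image_subgraph f) f.
  by have := isomorphism_onto f (image_subgraph f); rewrite f_emb eqxx => /andP[].
rewrite -(card_imset (f := fun s : {ffun H -> H} => [ffun u => f (s u)])); last first.
  move=> s t /ffunP eq_st; apply/ffunP=> u; apply: f_inj.
  by have := eq_st u; rewrite !ffunE.
have isoE (g : {ffun H -> G}) : isomorphism (image_subgraph f) g ->
    [/\ injective g, g @: [set: H] = f @: [set: H] &
     forall u v, adj u v = ([set g u; g v] \in (image_subgraph f).2)].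
  case/and3P=> /injectiveP g_inj /eqP gS /forallP adjE; split=> // u v.
  by apply/eqP; move/forallP: (adjE u).
have [_ _ fE] := isoE f f_iso.
have subf : subgraph (image_subgraph f).
  by have := isomorphism_onto f (image_subgraph f); rewrite f_emb eqxx => /andP[].
congr #|pred_of_set _|; apply/setP=> g.
rewrite inE [_ == image_subgraph f]eq_sym -isomorphism_onto subf /=.
apply/idP/imsetP => [/isoE[g_inj gS gE] | [s]].
  (* The automorphism relating g to f is f^-1 o g. *)
  have ex u : exists v, f v == g u.
    have : g u \in f @: [set: H] by rewrite -gS imset_f.
    by case/imsetP=> v _ ->; exists v.
  pose s := [ffun u => xchoose (ex u)].
  have fs u : f (s u) = g u by rewrite ffunE; apply/eqP; apply: xchooseP (ex u).
  exists s; last by apply/ffunP=> u; rewrite ffunE fs.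
  rewrite inE; apply/andP; split.
    by apply/injectiveP=> u v eq_s; apply: g_inj; rewrite -!fs eq_s.
  by apply/forallP=> u; apply/forallP=> v; rewrite gE fE !fs.
rewrite inE => /andP[/injectiveP s_inj /forallP s_adj] ->.
have {}s_adj u v : adj u v = adj (s u) (s v).
  by apply/eqP; move/forallP: (s_adj u).
apply/and3P; split.
- by apply/injectiveP=> u v; rewrite !ffunE => /f_inj/s_inj.
- have [t sK tK] := injF_bij s_inj.
  apply/eqP/setP=> z; apply/imsetP/imsetP => -[u _ ->].
    by exists (s u); rewrite ?ffunE.
  by exists (t u); rewrite ?ffunE ?tK.
- by apply/forallP=> u; apply/forallP=> v; rewrite !ffunE s_adj fE.
Qed.

Lemma copies_mul_automorphisms (H G : sgraph) :
  copies H G * #|automorphisms H| = #|embeddings H G|.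
Proof.
have copiesE : copies H G = #|image_subgraph (G := G) @: embeddings H G|.
  apply: eq_card => S; rewrite inE.
  apply/andP/imsetP => [[S_sub /existsP[f f_iso]] | [f f_emb ->]].
    have := isomorphism_onto f S; rewrite S_sub f_iso => /esym/andP[f_emb /eqP ->].
    by exists f.
  have := isomorphism_onto f (image_subgraph f); rewrite f_emb eqxx.
  by case/andP=> -> f_iso; split=> //; apply/existsP; exists f.
rewrite copiesE -[RHS]sum1_card (partition_big_imset (@image_subgraph H G)) /=.
rewrite -sum_nat_const; apply: eq_bigr => S /imsetP[f f_emb ->].
rewrite -(card_fiber f_emb) -sum1_card; apply: eq_bigl => g.
by rewrite inE.
Qed.

(** The number of automorphisms of [H] is a common factor of both sides, so
    embeddings may be counted in place of copies. *)
Lemma copies_lt_embeddings (H B G : sgraph) :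
  #|embeddings H B| < #|embeddings H G| -> copies H B < copies H G.
Proof.
by rewrite -!copies_mul_automorphisms ltn_mul2r => /andP[].
Qed.

(** * Counting coloured injections *)

(** Unless [a = b = m], one of the two falling factorials vanishes. *)
Lemma ffact_complement_le m a b : a + b = m.*2 -> a ^_ m * b ^_ m <= m`! ^ 2.
Proof.
move=> ab; have [a_lt|a_ge] := ltnP a m; first by rewrite ffact_small.
have [b_lt|b_ge] := ltnP b m; first by rewrite (ffact_small b_lt) muln0.
have [-> ->] : a = m /\ b = m by lia.
by rewrite ffactnn -mulnn.
Qed.

(** Such an [f] is a pair of injections, of one colour class into [A] and of
    the other into its complement. *)
Lemma card_coloured_injections (W T : finType) (A : {set T}) :
  #|T| = #|W|.*2 ->
  #|[set f : {ffun bool * W -> T} | injectiveb f &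
      [forall v, (f v \in A) == v.1]]| <= #|W|`! ^ 2.
Proof.
move=> cardT.
pose inj_on (B : {set T}) := [set g : {ffun W -> T} in ffun_on (mem B) | injectiveb g].
pose halves (f : {ffun bool * W -> T}) :=
  ([ffun w => f (true, w)], [ffun w => f (false, w)]).
have halves_inj : injective halves.
  move=> f g [/ffunP eq1 /ffunP eq0]; apply/ffunP=> -[[] w].
    by have := eq1 w; rewrite !ffunE.
  by have := eq0 w; rewrite !ffunE.
rewrite -(card_imset _ halves_inj).
apply: leq_trans (_ : #|setX (inj_on A) (inj_on (~: A))| <= _).
  apply: subset_leq_card; apply/subsetP=> _ /imsetP[f + ->].
  rewrite !inE => /andP[/injectiveP f_inj /forallP fA].
  apply/andP; split; apply/andP; split.
  - by apply/ffun_onP=> w; rewrite ffunE; rewrite (eqP (fA _)).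
  - by apply/injectiveP=> w w'; rewrite !ffunE => /f_inj[].
  - by apply/ffun_onP=> w; rewrite ffunE inE (eqP (fA _)).
  - by apply/injectiveP=> w w'; rewrite !ffunE => /f_inj[].
rewrite cardsX !card_inj_ffuns_on; apply: ffact_complement_le.
by rewrite cardsC.
Qed.

(** * The two graphs *)

(** Both graphs are described through a graph on [base p q], whose elements are
    p vertices [inl (inl i)], q vertices [inl (inr j)], the root [inr false] and
    the tip [inr true].  The small-side vertices [inl (inr j)] are joined to the
    vertices [inl (inl i)] and to the root, the root is joined to the tip, and
    the tip carries a loop. *)
Definition base p q : finType := ('I_p + 'I_q + bool)%type.

Definition base_adj p q (v w : base p q) : bool :=
  match v, w with
  | inl (inl _), inl (inr _) | inl (inr _), inl (inl _) => true
  | inl (inr _), inr false | inr false, inl (inr _) => true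
  | inr s, inr t => s || t
  | _, _ => false
  end.

Definition tip p q (v : base p q) : bool := if v is inr true then true else false.

(** The bipartite double cover of the base graph.  The boolean is the colour,
    so the loop at the tip becomes the edge joining the two tips, and the cover
    is two copies of K_{p+1,q}, each with a pendant tip, linked through their
    tips. *)
Definition cover_adj p q (v w : bool * base p q) : bool :=
  base_adj v.2 w.2 && (v.1 != w.1).

(** Away from the tips, edges are allowed also between equal booleans: the two
    copies of K_{p+1,q} merge into one K_{2(p+1),2q}, while the path
    root, tip, tip, root survives. *)
Definition thick_adj p q (v w : bool * base p q) : bool :=
  base_adj v.2 w.2 && ((v.1 != w.1) || ~~ (tip v.2 || tip w.2)).

Lemma cover_adj_sym p q : symmetric (@cover_adj p q).
Proof. by move=> [[] [[i|i]|[]]] [[] [[j|j]|[]]]. Qed.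

Lemma cover_adj_irrefl p q : irreflexive (@cover_adj p q).
Proof. by move=> v; rewrite /cover_adj eqxx andbF. Qed.

Lemma thick_adj_sym p q : symmetric (@thick_adj p q).
Proof. by move=> [[] [[i|i]|[]]] [[] [[j|j]|[]]]. Qed.

Lemma thick_adj_irrefl p q : irreflexive (@thick_adj p q).
Proof. by move=> [[] [[i|i]|[]]]. Qed.

Definition cover_graph p q := SGraph (@cover_adj_sym p q) (@cover_adj_irrefl p q).
Definition thick_graph p q := SGraph (@thick_adj_sym p q) (@thick_adj_irrefl p q).

Lemma card_base p q : #|base p q| = p + q + 2.
Proof. by rewrite !card_sum !card_ord card_bool. Qed.

Lemma card_cover_vertices p q : #|{: bool * base p q}| = (p + q + 2).*2.
Proof. by rewrite card_prod card_bool card_base mul2n. Qed.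

Lemma cover_graph_bipartite p q : bipartite (cover_graph p q).
Proof.
by exists [set v | v.1] => x y /andP[_]; rewrite !inE.
Qed.

Lemma thick_graph_triangle_free p q : triangle_free (thick_graph p q).
Proof. by move=> [[] [[i|i]|[]]] [[] [[j|j]|[]]] [[] [[k|k]|[]]]. Qed.

(** The path root, tip, tip, root closes to a 5-cycle through any common
    neighbour of the two roots. *)
Lemma thick_graph_not_bipartite p q : 0 < q -> ~ bipartite (thick_graph p q).
Proof.
move=> q_gt0 [A colA].
pose y : thick_graph p q := (true, inl (inr (Ordinal q_gt0))).
pose root b : thick_graph p q := (b, inr false).
pose top b : thick_graph p q := (b, inr true).
have := colA (top true) (root false) isT; have := colA (root false) y isT.
have := colA y (root true) isT; have := colA (root true) (top false) isT.
have := colA (top false) (top true) isT.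
by do 5!case: (_ \in A).
Qed.

(** The double cover is connected, so its colouring is unique up to a swap: it is
    forced on the two tips by the edge between them, then on the roots, on the
    small sides and on the large sides in turn. *)
Lemma cover_graph_colouring p q (c : bool * base p q -> bool) :
  0 < q -> (forall v w, cover_adj v w -> c v != c w) ->
  forall v, c v = v.1 (+) ~~ c (true, inr true).
Proof.
move=> q_gt0 c_col; set k := ~~ _.
have step w w' : base_adj w w' -> (forall b, c (b, w) = b (+) k) ->
    forall b, c (b, w') = b (+) k.
  move=> ww' cw b; have := c_col (~~ b, w) (b, w').
  rewrite /cover_adj /= ww' (cw (~~ b)) /= => /(_ _) cc.
  have : ~~ b (+) k != c (b, w') by apply: cc; case: (b).
  by case: (c _); case: (b); case: (k).
have c_tip b : c (b, inr true) = b (+) k.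
  have := c_col (true, inr true) (false, inr true) isT.
  by rewrite /k; case: b; case: (c _); case: (c _).
have c_root := step (inr true) (inr false) isT c_tip.
pose j0 := Ordinal q_gt0.
have c_Y j := step (inr false) (inl (inr j)) isT c_root.
have c_X i := step (inl (inr j0)) (inl (inl i)) isT (c_Y j0).
by move=> [b [[i|j]|[]]].
Qed.

(** * Counting embeddings *)

Lemma embeddings_into_bipartite p q (B : sgraph) :
  0 < q -> bipartite B -> #|B| = (p + q + 2).*2 ->
  #|embeddings (cover_graph p q) B| <= 2 * (p + q + 2)`! ^ 2.
Proof.
move=> q_gt0 [A colA] cardB.
pose coloured (A : {set B}) := [set f : {ffun bool * base p q -> B} |
  injectiveb f & [forall v, (f v \in A) == v.1]].
have coloured_le D : #|coloured D| <= (p + q + 2)`! ^ 2.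
  by rewrite -card_base; apply: card_coloured_injections; rewrite card_base.
apply: leq_trans (_ : #|coloured A :|: coloured (~: A)| <= _); last first.
  by rewrite mul2n -addnn (leq_trans (leq_card_setU _ _)) // leq_add.
apply: subset_leq_card; apply/subsetP=> f /embeddingsP[f_inj f_hom].
have col := @cover_graph_colouring p q (fun v => f v \in A) q_gt0 _.
have {}col := col (fun v w vw => colA _ _ (f_hom v w vw)).
rewrite !inE; have -> /= : injectiveb f by apply/injectiveP.
case: (f (true, inr true) \in A) col => col; apply/orP; [left|right].
  by apply/forallP=> v; rewrite col addbF.
by apply/forallP=> v; rewrite inE col addbT negbK.
Qed.

(** Permuting the two large sides together and the two small sides together,
    regardless of the colours of the vertices. *)
Definition thick_map p q (s : {perm (bool * 'I_p)} * {perm (bool * 'I_q)}) :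
    {ffun cover_graph p q -> thick_graph p q} :=
  [ffun v : bool * base p q =>
    match v with
    | (b, inl (inl i)) => ((s.1 (b, i)).1, inl (inl (s.1 (b, i)).2))
    | (b, inl (inr j)) => ((s.2 (b, j)).1, inl (inr (s.2 (b, j)).2))
    | _ => v
    end].

(** The colours of the moved vertices may change, but every edge at a moved vertex
    avoids the tips and so does not see colours in [thick_graph]. *)
Lemma thick_map_embedding p q s : @thick_map p q s \in embeddings _ _.
Proof.
apply/embeddingsP; split=> [v w | v w].
  rewrite !ffunE; case: v w => [b [[i|j]|t]] [b' [[i'|j']|t']] //=.
    case=> e1 e2; have /perm_inj[-> ->] // : s.1 (b, i) = s.1 (b', i').
    by rewrite [LHS]surjective_pairing e1 e2 -surjective_pairing.
  case=> e1 e2; have /perm_inj[-> ->] // : s.2 (b, j) = s.2 (b', j').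
  by rewrite [LHS]surjective_pairing e1 e2 -surjective_pairing.
rewrite !ffunE /adj /= /cover_adj /thick_adj.
by case: v w => [b [[i|j]|[]]] [b' [[i'|j']|[]]] //=; rewrite ?orbT ?orbF.
Qed.

Lemma thick_map_inj p q : injective (@thick_map p q).
Proof.
move=> s t /ffunP eq_st.
rewrite [s]surjective_pairing [t]surjective_pairing.
congr (_, _); apply/permP=> -[b i].
  have := eq_st (b, inl (inl i)); rewrite !ffunE /= => -[e1 e2].
  by rewrite [LHS]surjective_pairing e1 e2 -surjective_pairing.
have := eq_st (b, inl (inr i)); rewrite !ffunE /= => -[e1 e2].
by rewrite [LHS]surjective_pairing e1 e2 -surjective_pairing.
Qed.

Lemma card_perm_type (T : finType) : #|{perm T}| = #|T|`!.
Proof.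
have := card_perm [set: T]; rewrite cardsT => <-; rewrite -[LHS]cardsT; apply: eq_card => s.
by rewrite !inE; apply/esym/subsetP.
Qed.

Lemma embeddings_into_thick p q :
  p.*2`! * q.*2`! <= #|embeddings (cover_graph p q) (thick_graph p q)|.
Proof.
apply: leq_trans (_ : #|thick_map (p := p) (q := q) @: setT| <= _); last first.
  apply: subset_leq_card; apply/subsetP=> _ /imsetP[s _ ->].
  exact: thick_map_embedding.
rewrite card_imset; last exact: thick_map_inj.
by rewrite cardsT card_prod !card_perm_type !card_prod card_bool !card_ord !mul2n.
Qed.

(** * The matching *)

Lemma matching_of_injections (H : sgraph) (W : finType) (g g' : W -> H) :
  injective g -> injective g' -> (forall w w', g w != g' w') ->
  (forall w, adj (g w) (g' w)) ->
  exists M : {set {set H}},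
    [/\ matching M, #|M| = #|W| & #|unmatched M| = #|H| - #|W|.*2].
Proof.
move=> g_inj g'_inj gNg' gg'.
pose e w := [set g w; g' w].
have e_meet w w' z : z \in e w -> z \in e w' -> w = w'.
  rewrite !inE => /orP[]/eqP-> /orP[] => [/eqP/g_inj | | | /eqP/g'_inj] //.
    by rewrite (negPf (gNg' _ _)).
  by rewrite eq_sym (negPf (gNg' _ _)).
have e_inj : injective e.
  by move=> w w' eqe; apply: (e_meet w w' (g w)); rewrite -?eqe set21.
have e_triv : trivIset (e @: setT).
  apply/trivIsetP=> _ _ /imsetP[w _ ->] /imsetP[w' _ ->] ne.
  rewrite -setI_eq0; apply/eqP/setP=> z; rewrite in_set0.
  apply/negP=> /setIP[zw zw']; case/eqP: ne.
  by congr e; apply: e_meet zw zw'.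
have card_M : #|e @: setT| = #|W| by rewrite card_imset // cardsT.
exists (e @: setT); split=> //.
  rewrite /matching e_triv andbT; apply/subsetP=> _ /imsetP[w _ ->].
  by rewrite in_edges.
rewrite /unmatched cardsCs setCK; congr (_ - _).
rewrite -(eqP e_triv) (eq_bigr (fun=> 2)) ?sum_nat_const ?card_M ?muln2 //.
by move=> _ /imsetP[w _ ->]; rewrite cards2 gNg'.
Qed.

(** Each root is matched with its tip, and each small side is matched into the
    large side of its copy, which is larger by [u] once the root is left
    aside. *)
Lemma cover_graph_matching q u :
  exists M : {set {set cover_graph (q + u) q}},
    [/\ matching M, #|M| = q.+1.*2 & #|unmatched M| = u.*2].
Proof.
pose g (w : bool * option 'I_q) : cover_graph (q + u) q :=
  if w is (b, Some j) then (b, inl (inl (lshift u j))) else (w.1, inr false).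
pose g' (w : bool * option 'I_q) : cover_graph (q + u) q :=
  if w is (b, Some j) then (~~ b, inl (inr j)) else (~~ w.1, inr true).
have [||||M [M_match M_card M_un]] := @matching_of_injections (cover_graph (q + u) q) _ g g'.
- move=> [b [i|]] [b' [i'|]] //= => [[-> eq_i] | [->]] //.
  by congr (_, Some _); apply: val_inj.
- by move=> [b [i|]] [b' [i'|]] //= => [[/negb_inj -> ->] | [/negb_inj ->]].
- by move=> [b [i|]] [b' [i'|]]; apply/eqP.
- by move=> [[] [i|]].
exists M; rewrite M_un M_card card_cover_vertices.
rewrite card_prod card_bool card_option card_ord; split=> //; lia.
Qed.

(** * Unbalanced factorials *)

(** (N+2u)! N! / (N+u)!^2 is the product over i = 1..u of (N+u+i)/(N+i), and
    each factor is at least (m+1)/m because N + i <= N + u <= m u. *)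
Lemma fact_shift_le N u m : N + u <= m * u ->
  m.+1 ^ u * (N + u)`! ^ 2 <= m ^ u * ((N + u.*2)`! * N`!).
Proof.
move=> Nu.
suff H d : d <= u ->
    m.+1 ^ d * ((N + u)`! * (N + d)`!) <= m ^ d * ((N + u + d)`! * N`!).
  by have := H u (leqnn u); rewrite -addnA addnn mulnn.
elim: d => [|d IH] d_lt; first by rewrite !addn0.
have {}IH := IH (ltnW d_lt).
have fac : m.+1 * (N + d).+1 <= m * (N + u + d).+1 by nia.
have := leq_mul fac IH; rewrite !addnS !factS !expnS; nia.
Qed.

(** Bernoulli's inequality (1 + 1/m)^d >= 1 + d/m at d = m. *)
Lemma bernoulli_double m : 0 < m -> 2 * m ^ m <= m.+1 ^ m.
Proof.
move=> m_gt0; suff H d : m ^ d * (m + d) <= m * m.+1 ^ d.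
  by have := H m; rewrite -(leq_pmul2l m_gt0); nia.
elim: d => [|d IH]; first by rewrite !expn0; lia.
rewrite !expnS; have := leq_mul (leqnn m.+1) IH.
nia.
Qed.

Lemma exp_beats_quartic c n : exists2 j, n < j & 2 * (c * j + 2) ^ 4 < 2 ^ j.
Proof.
(* j is a multiple 8 i, so that 2^j = (2^i)^8 > i^8, and i is large enough for
   twice the base of the quartic to stay below i^2. *)
pose i := (c.+1 * 40 + n).+1.
exists (8 * i); first by rewrite /i; lia.
have lin : c * (8 * i) + 2 <= c.+1 * 10 * i by rewrite /i; nia.
have sq : 2 * (c * (8 * i) + 2) < i ^ 2 by rewrite /i -mulnn; nia.
have := ltn_expl i (leqnn 2) => i_lt.
have -> : 2 ^ (8 * i) = (2 ^ i) ^ 8 by rewrite mulnC expnM.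
apply: leq_ltn_trans (_ : _ <= (2 * (c * (8 * i) + 2)) ^ 4) _.
  by rewrite expnMn leq_mul.
apply: ltn_trans (_ : (i ^ 2) ^ 4 < _); first by rewrite ltn_exp2r.
by rewrite -expnM ltn_exp2r.
Qed.

(** Put m = 2k+1, so that p + q = m u when q = k u and p = q + u.  The gain
    ((m+1)/m)^u at least doubles each time u grows by m; taking u = m j makes it at least
    2^j.  The loss 2 ((m u + 1)(m u + 2))^2 comes from the roots and tips, which
    an embedding into a bipartite graph is free to move. *)
Lemma unbalanced_factorials_win k n0 : exists2 u, n0 < u &
  2 * (k * u + u + k * u + 2)`! ^ 2 < (k * u + u).*2`! * (k * u).*2`!.
Proof.
pose m := k.*2.+1.
have [j j_gt j_exp] := exp_beats_quartic (m * m) n0.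
exists (m * j); first by rewrite /m; nia.
set u := m * j; have mu : k * u + u + k * u = m * u by rewrite /m; nia.
have e1 : (k * u + u).*2 = (k * u).*2 + u.*2 by lia.
have e2 : (k * u).*2 + u = m * u by rewrite /m; nia.
have := @fact_shift_le (k * u).*2 u m; rewrite e2 => /(_ (leqnn _)).
rewrite mu e1.
set F := (m * u)`! ^ 2; set P := _ * (k * u).*2`! => FP.
have m_gt0 : 0 < m by [].
have two_j : 2 ^ j * m ^ u <= m.+1 ^ u.
  by rewrite /u !expnM -expnMn leq_exp2r ?bernoulli_double //; lia.
have F_gt0 : 0 < F by rewrite expn_gt0 fact_gt0.
have two_jP : 2 ^ j * F <= P.
  rewrite -(@leq_pmul2l (m ^ u)) ?expn_gt0 ?m_gt0 //.
  apply: leq_trans FP; rewrite mulnA [m ^ u * _]mulnC.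
  by rewrite leq_mul.
apply: leq_trans two_jP.
rewrite -(ltn_pmul2r F_gt0) in j_exp; apply: leq_ltn_trans j_exp.
have -> : m * m * j = m * u by rewrite /u mulnA.
rewrite addn2 !factS !expnMn -/F -mulnA leq_mul2l /=.
rewrite mulnA leq_mul2r; apply/orP; right.
by rewrite (@expnD _ 2 2) leq_mul // leq_exp2r.
Qed.

Local Open Scope ring_scope.

Theorem theorem4 (R : realType) (lambda : R) (n0 : nat)
    (lambda_gt0 : 0 < lambda) (n0_gt0 : (0 < n0)%N) :
  exists (x : nat) (H G : sgraph),
    [/\ bipartite H,
        exists M : {set {set H}},
          [/\ matching M, #|M| = x & #|unmatched M|%:R <= lambda * x%:R],
        [/\ triangle_free G, ~ bipartite G & (n0 < #|G|)%N]
      & forall B : sgraph, bipartite B -> #|B| = #|G| ->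
          (copies H B < copies H G)%N].
Proof.
pose k := Num.bound lambda^-1.
have k_big : 1 <= lambda * k%:R.
  rewrite -[X in X <= _](mulfV (lt0r_neq0 lambda_gt0)) ler_pM2l //.
  by apply/ltW/archi_boundP; rewrite invr_ge0 ltW.
have k_gt0 : (0 < k)%N.
  by case: (k) k_big => //; rewrite mulr0 ler10.
have [u u_gt win] := unbalanced_factorials_win k n0.
set q := (k * u)%N in win.
have q_gt0 : (0 < q)%N by rewrite /q; nia.
exists (q.+1.*2), (cover_graph (q + u) q), (thick_graph (q + u) q); split.
- exact: cover_graph_bipartite.
- have [M [M_match M_card M_un]] := cover_graph_matching q u.
  exists M; split=> //; rewrite M_un -!mul2n !natrM mulrCA ler_pM2l ?ltr0n //.
  apply: le_trans (_ : lambda * q%:R <= _); last first.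
    by rewrite ler_pM2l // ler_nat.
  by rewrite natrM mulrA ler_peMl.
- split; first exact: thick_graph_triangle_free.
    exact: thick_graph_not_bipartite.
  by rewrite card_cover_vertices; lia.
- move=> B B_bip B_card; apply: copies_lt_embeddings.
  rewrite card_cover_vertices in B_card.
  apply: leq_ltn_trans (embeddings_into_bipartite q_gt0 B_bip B_card) _.
  exact: leq_trans win (embeddings_into_thick _ _).
Qed.
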